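(* Let $N, C \ge 1$ be integers, let $S \in [0,1]^{N\times N}$, let $\Omega$ be the set of matrices $X=(x_{ki}) \in [0,1]^{C\times N}$ with $\sum_{k=1}^C x_{ki}=1$ for every $i\in\{1,\dots,N\}$, and let $f(X)=\|S-X^\top X\|_F^2$ for $X\in\mathbb R^{C\times N}$. There exists $\bar\tau>0$ such that, for any $\tau\in(0,\bar\tau)$, the sequence $\{X^n\}$ generated by the parallel gradient projection algorithm (defined in the context) from any starting point $X^0\in\Omega$ with constant step size $\tau_n\equiv\tau$ has the following properties: (i) The sequence $\{f(X^n)\}$ is non-increasing. In addition, it holds that $f(X^{n+1})<f(X^n)$ for all $n\ge 0$, unless $X^n$ is a critical point of the problem $\min_{X\in\Omega} f(X)$. (ii) The sequence $\{\|X^{n+1}-X^n\|_F\}$ converges to $0$; and thus, any accumulation point of $\{X^n\}$ is a critical point of the problem $\min_{X\in\Omega} f(X)$.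
   Context: $\|\cdot\|_F$ is the Frobenius norm on matrices and $\langle A,B\rangle_F=\operatorname{trace}(A^\top B)$ is the corresponding inner product; gradients on $\mathbb R^{C\times N}$ are taken with respect to it. The matrix $S$ is an observed similarity matrix among $N$ items, given by data. A matrix $\bar X$ is a critical point of $\min_{X\in\Omega} f(X)$ if $\bar X\in\Omega$ and $\langle\nabla f(\bar X),X-\bar X\rangle_F\ge 0$ for all $X\in\Omega$. Let $\Delta^C=\{\mathbf y\in\mathbb R^C : y_k\ge 0\ \forall k,\ \sum_{k=1}^C y_k=1\}$ be the unit simplex and $P_{\Delta^C}$ the Euclidean projection onto it. The parallel gradient projection algorithm with step sizes $\tau_n>0$ starts from $X^0\in\Omega$ and, writing $\mathbf x_i^n$ for the $i$-th column of $X^n$ and $\mathbf s_i$ for the $i$-th column of $S$, computes for each $n\ge 0$ and each $i=1,\dots,N$ $$\mathbf x_i^{n+1}=P_{\Delta^C}\bigl(\mathbf x_i^n-\tau_n\,\mathbf g_i^n\bigr),\qquad \mathbf g_i^n=-4\bigl(X^n\mathbf s_i-X^n(X^n)^\top\mathbf x_i^n\bigr),$$ and sets $X^{n+1}=[\mathbf x_1^{n+1},\dots,\mathbf x_N^{n+1}]$. The sequence $\{X^n\}$ is the infinite sequence obtained by running this iteration without any stopping criterion.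
   Formalization: The similarity matrix S is additionally assumed symmetric; without this the g_i need not be the gradient columns and the claim fails, e.g. for N=C=2, S=[[1/2,1],[0,1/2]], where f increases from points near the all-1/2 matrix for every τ>0. *)

(* Defs.v *)
From HB Require Import structures.
From mathcomp Require Import all_boot all_order all_algebra.
From mathcomp Require Import all_classical all_reals all_analysis.

Set Implicit Arguments.
Unset Strict Implicit.
Unset Printing Implicit Defensive.

Import Order.TTheory GRing.Theory Num.Theory.
Import numFieldNormedType.Exports.

Local Open Scope classical_set_scope.
Local Open Scope ring_scope.

Section Frobenius.
Context {R : realType} {m n : nat}.
Implicit Types A B X V : 'M[R]_(m, n).

Definition frob_inner A B : R := \tr (A^T *m B).

(* The library norm `|A| on matrices is the entrywise maximum, hence a separate
   definition; on 'cV[R]_n this is the Euclidean norm. *)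
Definition frob_norm A : R := Num.sqrt (frob_inner A A).

Definition gradient (f : 'M[R]_(m, n) -> R) X : 'M[R]_(m, n) :=
  \matrix_(i, j) 'd f X (delta_mx i j).

(* [gradient f X] represents the differential for the Frobenius product. *)
Lemma gradientP (f : 'M[R]_(m, n) -> R) X V :
  'd f X V = frob_inner (gradient f X) V.
Proof.
rewrite [in LHS](matrix_sum_delta V) linear_sum.
under eq_bigr do rewrite linear_sum /=.
rewrite exchange_big /frob_inner /mxtrace; apply: eq_bigr => j _.
rewrite mxE; apply: eq_bigr => i _.
by rewrite linearZ /= !mxE mulrC.
Qed.

Definition critical_point (Omega : set 'M[R]_(m, n)) (f : 'M[R]_(m, n) -> R)
    (Xbar : 'M[R]_(m, n)) : Prop :=
  Omega Xbar /\
  (forall X, Omega X -> 0 <= frob_inner (gradient f Xbar) (X - Xbar)).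

End Frobenius.

Section Simplex.
Context {R : realType} {C : nat}.

Definition simplex : set 'cV[R]_C :=
  [set y | (forall k, 0 <= y k 0) /\ \sum_k y k 0 = 1].

Definition proj (K : set 'cV[R]_C) (y : 'cV[R]_C) : 'cV[R]_C :=
  [get z | K z /\ (forall w, K w -> frob_norm (y - z) <= frob_norm (y - w))].

End Simplex.

Section ParallelGradientProjection.
Context {R : realType} {C N : nat}.
Implicit Types (S : 'M[R]_N) (X : 'M[R]_(C, N)).

Definition feasible : set 'M[R]_(C, N) :=
  [set X | (forall k i, 0 <= X k i <= 1) /\ (forall i, \sum_k X k i = 1)].

Definition objective S X : R := frob_norm (S - X^T *m X) ^+ 2.

(* Column i of the gradient of [objective S] when S is symmetric; for general S
   the gradient involves (S + S^T) / 2 in place of S. *)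
Definition pgp_dir S X (i : 'I_N) : 'cV[R]_C :=
  - 4%:R *: (X *m col i S - X *m X^T *m col i X).

Definition pgp_step S (tau : R) X : 'M[R]_(C, N) :=
  \matrix_(k, i) (proj simplex (col i X - tau *: pgp_dir S X i)) k 0.

Fixpoint pgp S (tau : nat -> R) X0 (n : nat) : 'M[R]_(C, N) :=
  if n is n'.+1 then pgp_step S (tau n') (pgp S tau X0 n') else X0.

End ParallelGradientProjection.

(* Main.v *)
Require Import Defs.
From HB Require Import structures.
From mathcomp Require Import all_boot all_order all_algebra.
From mathcomp Require Import all_classical all_reals all_analysis.
From mathcomp Require Import ring lra.
Import Order.TTheory GRing.Theory Num.Theory.
Import numFieldNormedType.Exports.
Local Open Scope classical_set_scope.
Local Open Scope ring_scope.

(* Write D = X^{n+1} - X^n and G for the gradient of f at X^n. The obtuse-angle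
   property of the projection gives |D|^2 + tau <G, D> <= 0, and f(X + D) differs
   from f(X) + <G, D> by at most M |D|^2 on the compact set Omega. Hence
   f(X^{n+1}) + |D|^2 <= f(X^n) as soon as tau (M + 1) <= 1, which yields descent,
   strict unless D = 0, and |D| -> 0. The obtuse-angle property then gives
   <G, Y - X^n> >= o(1), which passes to accumulation points. *)

(** * Algebra and inequalities of the Frobenius product *)

Section FrobeniusAlgebra.
Context {R : realType}.

Lemma frob_innerE {m n} (A B : 'M[R]_(m, n)) :
  frob_inner A B = \sum_i \sum_j A i j * B i j.
Proof.
rewrite /frob_inner /mxtrace exchange_big /=; apply: eq_bigr => j _.
by rewrite mxE; apply: eq_bigr => i _; rewrite mxE.
Qed.

Lemma frob_inner_linear {m n} (A : 'M[R]_(m, n)) : linear (frob_inner A).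
Proof. by move=> a B D; rewrite /frob_inner mulmxDr -scalemxAr linearP. Qed.

HB.instance Definition _ {m n} (A : 'M[R]_(m, n)) :=
  GRing.isLinear.Build R 'M[R]_(m, n) R *%R (frob_inner A) (frob_inner_linear A).

Lemma frob_innerC {m n} (A B : 'M[R]_(m, n)) : frob_inner A B = frob_inner B A.
Proof.
by rewrite !frob_innerE; do 2![apply: eq_bigr => ? _]; rewrite mulrC.
Qed.

Lemma frob_innerDl {m n} (A B D : 'M[R]_(m, n)) :
  frob_inner (A + B) D = frob_inner A D + frob_inner B D.
Proof. by rewrite frob_innerC linearD /= !(frob_innerC D). Qed.

Lemma frob_innerDr {m n} (A B D : 'M[R]_(m, n)) :
  frob_inner A (B + D) = frob_inner A B + frob_inner A D.
Proof. by rewrite linearD. Qed.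

Lemma frob_innerNl {m n} (A B : 'M[R]_(m, n)) :
  frob_inner (- A) B = - frob_inner A B.
Proof. by rewrite frob_innerC linearN frob_innerC. Qed.

Lemma frob_innerNr {m n} (A B : 'M[R]_(m, n)) :
  frob_inner A (- B) = - frob_inner A B.
Proof. by rewrite linearN. Qed.

Lemma frob_innerZl {m n} a (A B : 'M[R]_(m, n)) :
  frob_inner (a *: A) B = a * frob_inner A B.
Proof. by rewrite frob_innerC linearZ /= frob_innerC. Qed.

Lemma frob_innerZr {m n} a (A B : 'M[R]_(m, n)) :
  frob_inner A (a *: B) = a * frob_inner A B.
Proof. by rewrite linearZ. Qed.

Definition frob_lin := (@frob_innerDl, @frob_innerDr, @frob_innerNl,
  @frob_innerNr, @frob_innerZl, @frob_innerZr).

Lemma frob_inner_trmx {m n} (A B : 'M[R]_(m, n)) :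
  frob_inner A^T B^T = frob_inner A B.
Proof.
rewrite !frob_innerE exchange_big /=.
by do 2![apply: eq_bigr => ? _]; rewrite !mxE.
Qed.

Lemma frob_inner_mull {m n p} (A : 'M[R]_(m, n)) (B : 'M[R]_(n, p)) D :
  frob_inner (A *m B) D = frob_inner B (A^T *m D).
Proof. by rewrite /frob_inner trmx_mul mulmxA. Qed.

Lemma frob_inner_ge0 {m n} (A : 'M[R]_(m, n)) : 0 <= frob_inner A A.
Proof.
by rewrite frob_innerE; do 2![apply: sumr_ge0 => ? _]; rewrite -expr2 sqr_ge0.
Qed.

Lemma frob_inner_eq0 {m n} (A : 'M[R]_(m, n)) : frob_inner A A = 0 -> A = 0.
Proof.
rewrite frob_innerE => /eqP; rewrite psumr_eq0 => [/allP A0|i _]; last first.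
  by apply: sumr_ge0 => j _; rewrite -expr2 sqr_ge0.
apply/matrixP => i j; rewrite mxE.
have /(_ (mem_index_enum _)) := A0 i.
rewrite psumr_eq0 => [/allP Ai0|k _]; last first.
  by rewrite -expr2 sqr_ge0.
by have /(_ (mem_index_enum _)) := Ai0 j; rewrite -expr2 sqrf_eq0 => /eqP.
Qed.

(** The squared norm of <B,B> A - <A,B> B expands to <B,B> (<A,A> <B,B> - <A,B>^2) and is
    nonnegative. *)
Lemma frob_inner_CS {m n} (A B : 'M[R]_(m, n)) :
  frob_inner A B ^+ 2 <= frob_inner A A * frob_inner B B.
Proof.
have [B0|B0] := eqVneq (frob_inner B B) 0.
  by rewrite (frob_inner_eq0 _ B0) !linear0 expr0n mulr0.
have Bgt0 : 0 < frob_inner B B by rewrite lt_def B0 frob_inner_ge0.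
have := frob_inner_ge0 (frob_inner B B *: A - frob_inner A B *: B).
rewrite !frob_lin (frob_innerC B A) => h.
by rewrite -subr_ge0 -(pmulr_rge0 _ Bgt0); lra.
Qed.

Lemma frob_inner_AMGM {m n} (A B : 'M[R]_(m, n)) :
  2 * frob_inner A B <= frob_inner A A + frob_inner B B.
Proof.
have := frob_inner_ge0 (A - B); rewrite !frob_lin (frob_innerC B A); lra.
Qed.

(** Each entry of the product pairs a row of [A] with a column of [B]; Cauchy-Schwarz bounds its
    square, and the double sum of the bounds factors. *)
Lemma frob_inner_mul_le {m n p} (A : 'M[R]_(m, n)) (B : 'M[R]_(n, p)) :
  frob_inner (A *m B) (A *m B) <= frob_inner A A * frob_inner B B.
Proof.
rewrite (frob_innerE (A *m B)) (frob_innerE A) mulr_suml; apply: ler_sum => i _.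
rewrite -(frob_inner_trmx B) (frob_innerE B^T) mulr_sumr; apply: ler_sum => j _.
have := frob_inner_CS (row i A) (row j B^T).
rewrite !frob_innerE !big_ord1 expr2 => h.
rewrite !mxE.
have e : \sum_k A i k * B k j = \sum_k row i A 0 k * row j B^T 0 k.
  by apply: eq_bigr => k _; rewrite !mxE.
rewrite e; apply: (le_trans h); rewrite le_eqVlt; apply/orP; left; apply/eqP.
by congr (_ * _); apply: eq_bigr => k _; rewrite !mxE.
Qed.

Lemma frob_inner_le_const {m n} (A : 'M[R]_(m, n)) (c : R) :
  (forall i j, `|A i j| <= c) -> frob_inner A A <= (m * n)%:R * c ^+ 2.
Proof.
move=> Ac; rewrite frob_innerE.
apply: (le_trans (y := \sum_(i < m) \sum_(j < n) c ^+ 2)).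
  apply: ler_sum => i _; apply: ler_sum => j _.
  by rewrite -expr2 -real_normK ?num_real // lerXn2r// ?nnegrE//
    (le_trans _ (Ac i j)).
by rewrite !sumr_const !card_ord -mulrnA mulr_natl mulnC.
Qed.

End FrobeniusAlgebra.
Lemma frob_innerDD_le {R : realType} {m n} (A B : 'M[R]_(m, n)) :
  frob_inner (A + B) (A + B) <= 2 * frob_inner A A + 2 * frob_inner B B.
Proof.
have := frob_inner_AMGM A B; rewrite !frob_lin (frob_innerC B A); lra.
Qed.

Lemma frob_innerBB {R : realType} {m n} (A B : 'M[R]_(m, n)) :
  frob_inner (A - B) (A - B) =
  frob_inner A A - 2 * frob_inner A B + frob_inner B B.
Proof. rewrite !frob_lin (frob_innerC B A); ring. Qed.

(** * Expansion and gradient of the objective *)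

Section Objective.
Context {R : realType} {C N : nat} (S : 'M[R]_N).
Implicit Types X D Y : 'M[R]_(C, N).

Definition residual X : 'M[R]_N := S - X^T *m X.

Definition grad_objective X : 'M[R]_(C, N) := - 4%:R *: (X *m residual X).

(** The part of f(X + D) - f(X) of degree at least two in [D]; [P] is the increment (X + D)^T (X +
    D) - X^T X. *)
Definition objective_rem X D : R :=
  let P := X^T *m D + D^T *m (X + D) in
  frob_inner P P - 2 * frob_inner (residual X) (D^T *m D).

Lemma objectiveE X : objective S X = frob_inner (residual X) (residual X).
Proof. by rewrite /objective /frob_norm sqr_sqrtr// frob_inner_ge0. Qed.

Lemma objective_ge0 X : 0 <= objective S X.
Proof. by rewrite objectiveE frob_inner_ge0. Qed.

(** This is the exact expansion of |E - P|^2 with E the residual. Symmetry of [S] makes E symmetric,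
    so X^T D and D^T X pair equally with E; hence the factor 4 in the gradient. *)
Lemma objective_taylor X D : S^T = S ->
  objective S (X + D) =
  objective S X + frob_inner (grad_objective X) D + objective_rem X D.
Proof.
move=> Ssym; rewrite !objectiveE /objective_rem /=.
set P := X^T *m D + _; set E := residual X.
have -> : residual (X + D) = E - P.
  rewrite /E /P /residual [(X + D)^T]linearD /= !mulmxDl !mulmxDr.
  by rewrite !opprD !addrA; do !congr (_ + _); rewrite addrAC.
have ET : E^T = E by rewrite /E /residual linearB /= trmx_mul trmxK Ssym.
have -> : frob_inner (grad_objective X) D = - 4 * frob_inner E (X^T *m D).
  by rewrite frob_innerZl frob_inner_mull.
have EL : frob_inner E (D^T *m X) = frob_inner E (X^T *m D).
  by rewrite -frob_inner_trmx ET trmx_mul trmxK.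
rewrite frob_innerBB.
have -> : frob_inner E P = 2 * frob_inner E (X^T *m D) + frob_inner E (D^T *m D).
  by rewrite /P mulmxDr !frob_innerDr EL; ring.
ring.
Qed.

(** Since <E, D^T D> = <D E, D>, its double is at most |D E|^2 + |D|^2 in absolute value; the rest
    is submultiplicativity of the norm. *)
Lemma objective_rem_le X D :
  `|objective_rem X D| <= (frob_inner (residual X) (residual X) + 1
    + 2 * frob_inner X X + 2 * frob_inner (X + D) (X + D)) * frob_inner D D.
Proof.
rewrite /objective_rem /=; set E := residual X; set Z := X + D.
have EQ : frob_inner E (D^T *m D) = frob_inner (D *m E) D.
  by rewrite frob_inner_mull.
have h1 := frob_inner_AMGM (D *m E) D.
have h2 := frob_inner_AMGM (- (D *m E)) D.
have h3 := frob_inner_mul_le D E.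
have h4 := frob_innerDD_le (X^T *m D) (D^T *m Z).
have h5 := frob_inner_mul_le X^T D.
have h6 := frob_inner_mul_le D^T Z.
have h7 := frob_inner_ge0 (X^T *m D + D^T *m Z).
rewrite !frob_lin in h2; rewrite !frob_inner_trmx in h5 h6.
rewrite !EQ ler_norml; apply/andP; split; lra.
Qed.

(** The differential refers to the entrywise maximum norm; this converts quadratic Frobenius bounds
    to that norm. *)
Lemma frob_innerM_le_norm D : frob_inner D D <= (C * N)%:R * `|D| ^+ 2.
Proof.
apply: frob_inner_le_const => i j.
rewrite [leRHS]/Num.norm /= mx_normrE.
exact: (le_bigmax _ (fun ij : 'I_C * 'I_N => `|D ij.1 ij.2|) (i, j)).
Qed.

Lemma frob_inner_continuous X : continuous (frob_inner X).
Proof.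
move=> D.
rewrite (_ : frob_inner X = fun D => \sum_i \sum_j X i j * D i j); last first.
  by apply/funext => Y; rewrite frob_innerE.
apply: (continuous_big (fun xy => add_continuous xy)) => i _.
apply: (continuous_big (fun xy => add_continuous xy)) => j _ Y.
apply: continuousM; first exact: cst_continuous.
exact: coord_continuous.
Qed.

Lemma gradient_objective X : S^T = S ->
  gradient (objective S) X = grad_objective X.
Proof.
move=> Ssym.
have dE : 'd (objective S) X = frob_inner (grad_objective X) :> (_ -> _).
  apply: diff_unique; first exact: frob_inner_continuous.
  apply/eqaddoP => e e0.
pose c : R := (C * N)%:R.
(* [K] bounds the factor in [objective_rem_le] once |D| <= 1: in the Frobenius norm, 2 |X + D|^2 <=
   4 |X|^2 + 4 |D|^2 and |D|^2 <= c. *)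
pose K : R := frob_inner (residual X) (residual X) + 1
  + 2 * frob_inner X X + 4 * frob_inner X X + 4 * c.
have c0 : 0 <= c by exact: ler0n.
have K0 : 0 <= K.
  by rewrite /K !addr_ge0 ?mulr_ge0 ?frob_inner_ge0.
have Kc0 : 0 <= K * c by rewrite mulr_ge0.
have Kc1 : 0 < K * c + 1 by rewrite ltr_pwDr.
near=> D.
have D1 : `|D| <= 1.
  near: D; apply/nbhs_ballP; exists 1 => //= D; rewrite -ball_normE /= sub0r normrN.
  exact: ltW.
(* This radius gives K c |D|^2 <= e |D|; adding 1 keeps the denominator positive even if K c = 0. *)
have De : `|D| <= e / (K * c + 1).
  near: D; apply/nbhs_ballP; exists (e / (K * c + 1)) => /=.
    by rewrite divr_gt0.
  by move=> D; rewrite -ball_normE /= sub0r normrN => /ltW.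
have -> : ((objective S \o shift X)
    - (cst (objective S X) + frob_inner (grad_objective X))) D = objective_rem X D.
  rewrite !fctE /= [D + X]addrC objective_taylor// /cst; ring.
have nD := frob_innerM_le_norm D; rewrite -/c in nD.
have nD1 : frob_inner D D <= c.
  by rewrite (le_trans nD)// ler_piMr// exprn_ile1.
apply: (le_trans (objective_rem_le X D)).
apply: (le_trans (y := K * (c * `|D| ^+ 2))).
  apply: ler_pM => //; rewrite ?frob_inner_ge0//.
    by rewrite !addr_ge0 ?mulr_ge0 ?frob_inner_ge0.
  have := frob_innerDD_le X D; rewrite /K; lra.
rewrite expr2 !mulrA ler_wpM2r//.
apply: (le_trans (y := K * c * (e / (K * c + 1)))); first by rewrite ler_wpM2l.
by rewrite mulrCA ler_piMr ?(ltW e0)// ler_pdivrMr// mul1r lerDl.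
(* Entry (i, j) of the gradient is the differential at [delta_mx i j], whose pairing with
   [grad_objective] leaves a single term. *)
apply/matrixP => i j.
rewrite mxE dE frob_innerE (bigD1 i)//= (bigD1 j)//=.
rewrite [X in _ + X]big1 => [|k ki]; last first.
  by rewrite big1// => l _; rewrite [delta_mx _ _ _ _]mxE (negbTE ki) mulr0.
rewrite [X in _ + X + _]big1 => [|k kj]; last first.
  by rewrite [delta_mx _ _ _ _]mxE (negbTE kj) andbF mulr0.
by rewrite [delta_mx _ _ _ _]mxE !eqxx mulr1 !addr0.
Unshelve. all: by end_near. Qed.

End Objective.

(** * Euclidean projection onto the simplex *)

Section Projection.
Context {R : realType} {C : nat}.
Implicit Types y z w : 'cV[R]_C.

Lemma frob_inner_cV y z : frob_inner y z = \sum_k y k 0 * z k 0.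
Proof. by rewrite frob_innerE; apply: eq_bigr => k _; rewrite big_ord1. Qed.

(* Water-filling: the projection is the positive part of y - lambda, where the
   level lambda is chosen so that the entries sum to 1. *)
Lemma simplex_level y : (0 < C)%N ->
  exists l : R, \sum_k Num.max (y k 0 - l) 0 = 1.
Proof.
move=> C0; pose g l := \sum_k Num.max (y k 0 - l) 0.
(* Bracket for the intermediate value theorem: at level [a] the first term alone is 1, at level [b]
   every term vanishes. The outer maximum ensures a <= b. *)
pose a := y (Ordinal C0) 0 - 1.
pose b := Num.max a (\sum_k `|y k 0|).
have ga : 1 <= g a.
  rewrite /g (bigD1 (Ordinal C0))//= {1}/a opprB addrCA subrr addr0.
  rewrite -[leLHS]addr0 lerD//; first by rewrite le_max lexx.
  by apply: sumr_ge0 => k _; rewrite le_max lexx orbT.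
have gb : g b <= 1.
  rewrite /g big1// => k _; apply/max_idPr; rewrite subr_le0.
  rewrite le_max; apply/orP; right; rewrite (le_trans (ler_norm _))//.
  by rewrite (bigD1 k)//= lerDl sumr_ge0.
have gc : continuous g.
  apply: (continuous_big (fun xy => add_continuous xy)) => k _ l.
  apply: (@continuous_max R R (fun l => y k 0 - l) (cst 0)).
    by apply: continuousB; [exact: cst_continuous|exact: id].
  exact: cst_continuous.
have ab : a <= b by rewrite le_max lexx.
have [||l _ gl] := @IVT R g a b 1 ab.
- exact: continuous_subspaceT.
- by rewrite ge_min le_max ga gb orbT.
by exists l.
Qed.

Lemma simplex_projection_exists y : (0 < C)%N ->
  exists z, simplex z /\ forall w, simplex w -> frob_inner (y - z) (w - z) <= 0.
Proof.
move=> /(simplex_level y)[l yl].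
pose z : 'cV[R]_C := \col_k Num.max (y k 0 - l) 0.
have z1 : \sum_k z k 0 = 1 by rewrite -[RHS]yl; apply: eq_bigr => k _; rewrite mxE.
exists z; split.
  by split=> // k; rewrite mxE le_max lexx orbT.
move=> w [w0 w1]; rewrite frob_inner_cV.
(* Where z_k > 0, the difference y_k - z_k is l; where z_k = 0, it is at most l while w_k - z_k >=
   0. The bound sums to 0 because [w] and [z] have the same total. *)
apply: (le_trans (y := \sum_k l * (w k 0 - z k 0))).
  apply: ler_sum => k _; rewrite !mxE.
  have := w0 k; move: (w k 0) (y k 0) => u v u0.
  by case: (leP (v - l) 0) => h; nra.
by rewrite -mulr_sumr sumrB w1 z1 subrr mulr0.
Qed.

Lemma frob_norm_le y z :
  (frob_norm y <= frob_norm z) = (frob_inner y y <= frob_inner z z).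
Proof. by rewrite /frob_norm ler_sqrt// frob_inner_ge0. Qed.

Lemma proj_simplexP y : (0 < C)%N ->
  simplex (Defs.proj simplex y) /\
  forall w, simplex w ->
    frob_inner (y - Defs.proj simplex y) (w - Defs.proj simplex y) <= 0.
Proof.
move=> C0; have [z [zs zle]] := simplex_projection_exists y C0.
have pyth w : frob_inner (y - w) (y - w) = frob_inner (y - z) (y - z)
    + frob_inner (w - z) (w - z) - 2 * frob_inner (y - z) (w - z).
  have -> : y - w = (y - z) - (w - z) by rewrite opprB addrA subrK.
  rewrite frob_innerBB; ring.
have : exists p, simplex p /\
    forall w, simplex w -> frob_norm (y - p) <= frob_norm (y - w).
  exists z; split=> // w ws; rewrite frob_norm_le (pyth w).
  by have := zle _ ws; have := frob_inner_ge0 (w - z); lra.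
move=> /getPex; rewrite -/(Defs.proj simplex y).
set p := Defs.proj simplex y => -[ps pmin].
suff -> : p = z by [].
apply: subr0_eq; apply: frob_inner_eq0; apply: le_anti; rewrite frob_inner_ge0 andbT.
have := pmin _ zs; rewrite frob_norm_le (pyth p); have := zle _ ps; lra.
Qed.

End Projection.

(** * One iteration as a projection onto the feasible set *)

Section Step.
Context {R : realType} {C N : nat} (S : 'M[R]_N).
Implicit Types X Y : 'M[R]_(C, N).

Lemma feasible_simplex X : feasible X <-> forall i, simplex (col i X).
Proof.
split=> [[X01 X1] i|Xs].
  split=> [k|]; first by rewrite mxE; case/andP: (X01 k i).
  by rewrite -[RHS](X1 i); apply: eq_bigr => k _; rewrite mxE.
have X0 k i : 0 <= X k i by have [/(_ k)] := Xs i; rewrite mxE.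
have X1 i : \sum_k X k i = 1.
  by have [_ <-] := Xs i; apply: eq_bigr => k _; rewrite mxE.
split=> // k i; rewrite X0/= -(X1 i) (bigD1 k)//= lerDl sumr_ge0//.
Qed.

Lemma pgp_dirE X i : pgp_dir S X i = col i (grad_objective S X).
Proof.
rewrite /pgp_dir /grad_objective /residual linearZ /=; congr (_ *: _).
by rewrite mulmxBr linearB /= !colE !mulmxA.
Qed.

Lemma frob_inner_col X Y : frob_inner X Y = \sum_i frob_inner (col i X) (col i Y).
Proof.
rewrite frob_innerE exchange_big /=; apply: eq_bigr => i _.
by rewrite frob_inner_cV; apply: eq_bigr => k _; rewrite !mxE.
Qed.

(** The feasible set is a product of simplices and the Frobenius product is a sum over columns, so
    the columnwise obtuse-angle inequalities add up to one for the whole matrix. *)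
Lemma pgp_stepP tau X : (0 < C)%N ->
  feasible (pgp_step S tau X) /\
  forall Y, feasible Y ->
    frob_inner (X - tau *: grad_objective S X - pgp_step S tau X)
      (Y - pgp_step S tau X) <= 0.
Proof.
move=> C0; set W := pgp_step S tau X.
have Wi i : col i W = Defs.proj simplex (col i (X - tau *: grad_objective S X)).
  apply/colP => k; rewrite !mxE; congr (Defs.proj _ _ _ _).
  by rewrite pgp_dirE !colE mulmxBl -(scalemxAl tau).
split=> [|Y /(feasible_simplex Y).1 Ys].
  by apply: (feasible_simplex W).2 => i; rewrite Wi; exact: (proj_simplexP _ C0).1.
rewrite frob_inner_col; apply: sumr_le0 => i _.
rewrite !colE !(mulmxBl _ W) -!colE Wi.
exact: (proj_simplexP _ C0).2.
Qed.

End Step.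

(** * Continuity of matrix expressions *)

Section EntrywiseContinuity.
Context {R : realType} {T : topologicalType}.

(** Working entry by entry reduces matrix products to finite sums of products of real functions. *)
Definition entry_continuous {m n} (F : T -> 'M[R]_(m, n)) :=
  forall i j, continuous (fun x => F x i j).

Lemma continuous_sum {n} (F : 'I_n -> T -> R) :
  (forall i, continuous (F i)) -> continuous (fun x => \sum_i F i x).
Proof.
by move=> Fc; apply: (continuous_big (fun xy => add_continuous xy)) => i _.
Qed.

Lemma entry_continuous_cst {m n} (A : 'M[R]_(m, n)) :
  entry_continuous (fun=> A).
Proof. by move=> i j; exact: cst_continuous. Qed.

Lemma entry_continuousB {m n} (F G : T -> 'M[R]_(m, n)) :
  entry_continuous F -> entry_continuous G ->
  entry_continuous (fun x => F x - G x).
Proof.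
move=> Fc Gc i j x.
rewrite (_ : (fun x => _) = (fun x => F x i j) - (fun x => G x i j)).
  by apply: continuousB; [exact: Fc|exact: Gc].
by apply/funext => y; rewrite !mxE.
Qed.

Lemma entry_continuousZ {m n} a (F : T -> 'M[R]_(m, n)) :
  entry_continuous F -> entry_continuous (fun x => a *: F x).
Proof.
move=> Fc i j x.
rewrite (_ : (fun x => _) = (cst a \* (fun x => F x i j))).
  by apply: continuousM; [exact: cst_continuous|exact: Fc].
by apply/funext => y; rewrite !mxE.
Qed.

Lemma entry_continuous_tr {m n} (F : T -> 'M[R]_(m, n)) :
  entry_continuous F -> entry_continuous (fun x => (F x)^T).
Proof.
move=> Fc i j.
rewrite (_ : (fun x => _) = (fun x => F x j i)); first exact: Fc.
by apply/funext => y; rewrite !mxE.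
Qed.

Lemma entry_continuousM {m n p} (F : T -> 'M[R]_(m, n)) (G : T -> 'M[R]_(n, p)) :
  entry_continuous F -> entry_continuous G ->
  entry_continuous (fun x => F x *m G x).
Proof.
move=> Fc Gc i j.
rewrite (_ : (fun x => _) = (fun x => \sum_k F x i k * G x k j)).
  apply: continuous_sum => k x.
  by apply: continuousM; [exact: Fc|exact: Gc].
by apply/funext => y; rewrite !mxE.
Qed.

Lemma frob_inner_entry_continuous {m n} (F G : T -> 'M[R]_(m, n)) :
  entry_continuous F -> entry_continuous G ->
  continuous (fun x => frob_inner (F x) (G x)).
Proof.
move=> Fc Gc; rewrite /frob_inner /mxtrace; apply: continuous_sum => k.
by apply: entry_continuousM => //; exact: entry_continuous_tr.
Qed.

End EntrywiseContinuity.

(** * Descent estimate, criticality and closedness of the feasible set *)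

Section Descent.
Context {R : realType} {C N : nat} (S : 'M[R]_N).
Hypotheses (C0 : (0 < C)%N) (Ssym : S^T = S).
Implicit Types X Y : 'M[R]_(C, N).

Lemma feasible_frob_le X : feasible X -> frob_inner X X <= (C * N)%:R.
Proof.
move=> [X01 _]; rewrite -[leRHS]mulr1 -[X in _ * X](expr1n _ 2).
apply: frob_inner_le_const => i j.
by case/andP: (X01 i j) => h0 h1; rewrite ger0_norm.
Qed.

(** For feasible X and X + D this dominates the factor in [objective_rem_le]: both squared norms are
    at most C N, and |S - X^T X|^2 <= 2 |S|^2 + 2 (C N)^2. *)
Definition remainder_bound : R :=
  2 * frob_inner S S + 2 * (C * N)%:R ^+ 2 + 1 + 4 * (C * N)%:R.

Lemma remainder_bound_ge0 : 0 <= remainder_bound.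
Proof.
by rewrite /remainder_bound !addr_ge0 ?mulr_ge0 ?frob_inner_ge0 ?sqr_ge0.
Qed.

Lemma pgp_step_descent tau X : 0 < tau -> tau * (remainder_bound + 1) <= 1 ->
  feasible X ->
  objective S (pgp_step S tau X)
    + frob_inner (pgp_step S tau X - X) (pgp_step S tau X - X)
  <= objective S X.
Proof.
move=> t0 t1 Xf; have [Wf Wle] := pgp_stepP S tau X C0.
set W := pgp_step S tau X in Wf Wle *; set D := W - X.
set G := grad_objective S X in Wle *.
have WE : W = X + D by rewrite /D addrC subrK.
have := Wle X Xf.
have -> : X - tau *: G - W = - (D + tau *: G).
  by rewrite WE opprD addrACA subrr add0r -opprD [D + _]addrC.
have -> : X - W = - D by rewrite /D opprB.
rewrite frob_innerNl frob_innerNr opprK frob_innerDl frob_innerZl => obt.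
have fW : objective S W = objective S X + frob_inner G D + objective_rem S X D.
  by rewrite {1}WE objective_taylor.
have remle : objective_rem S X D <= remainder_bound * frob_inner D D.
  apply: (le_trans (ler_norm _)); apply: (le_trans (objective_rem_le _ _ _)).
  rewrite ler_wpM2r ?frob_inner_ge0// -WE.
  have hX := feasible_frob_le _ Xf; have hW := feasible_frob_le _ Wf.
  have hE : frob_inner (residual S X) (residual S X)
      <= 2 * frob_inner S S + 2 * (C * N)%:R ^+ 2.
    apply: (le_trans (frob_innerDD_le _ _)).
    rewrite frob_innerNl frob_innerNr opprK lerD2l ler_wpM2l//.
    apply: (le_trans (frob_inner_mul_le _ _)); rewrite frob_inner_trmx -expr2.
    by rewrite lerXn2r// nnegrE ?frob_inner_ge0.
  rewrite /remainder_bound; lra.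
have D0 := frob_inner_ge0 D.
have h : tau * (remainder_bound + 1) * frob_inner D D <= frob_inner D D.
  by rewrite ler_piMl.
(* After multiplication by [tau], [obt] bounds tau <G, D> by -|D|^2, which absorbs tau (rem + |D|^2)
   <= tau (M + 1) |D|^2 <= |D|^2. *)
rewrite fW -(ler_pM2l t0).
have h2 : tau * objective_rem S X D <= tau * (remainder_bound * frob_inner D D).
  by rewrite ler_wpM2l// ltW.
lra.
Qed.

(** At a fixed point the obtuse-angle inequality reduces to -tau <G, Y - X> <= 0. *)
Lemma pgp_step_fixed_critical tau X : 0 < tau -> feasible X ->
  pgp_step S tau X = X -> critical_point feasible (objective S) X.
Proof.
move=> t0 Xf WX; split=> // Y Yf; rewrite gradient_objective//.
have [_ /(_ Y Yf)] := pgp_stepP S tau X C0; rewrite WX.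
rewrite [X - _ - X]addrAC subrr sub0r frob_innerNl frob_innerZl oppr_le0.
by rewrite pmulr_rge0.
Qed.

(* The variational inequality of the step, freed of the new iterate: the defect
   is controlled by the step length through AM-GM. *)
Lemma pgp_step_variational (tau e : R) X Y : 0 < e -> feasible Y ->
  let D := pgp_step S tau X - X in
  let V := Y - X - tau *: grad_objective S X in
  frob_inner D D <= 4 * e ^+ 2 ->
  0 <= tau * frob_inner (grad_objective S X) (Y - X) + e * frob_inner V V + e.
Proof.
move=> e0 Yf D V De; have [_ /(_ Y Yf)] := pgp_stepP S tau X C0.
set W := pgp_step S tau X in D De *; set G := grad_objective S X in V *.
have WE : W = X + D by rewrite /D addrC subrK.
have -> : X - tau *: G - W = - (D + tau *: G).
  by rewrite WE opprD addrACA subrr add0r -opprD [D + _]addrC.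
have -> : Y - W = (Y - X) - D by rewrite WE opprD addrA.
(* The weight 2 e balances both terms: 4 e <D, V> <= |D|^2 + 4 e^2 |V|^2 <= 4 e^2 (1 + |V|^2),
   whence [am2] after division by 4 e. *)
have := frob_inner_AMGM D ((2 * e) *: V).
have D0 := frob_inner_ge0 D.
rewrite frob_innerZl !frob_innerZr => am.
have VE : frob_inner D V = frob_inner D (Y - X) - tau * frob_inner D G.
  by rewrite /V frob_innerDr frob_innerNr frob_innerZr.
clearbody V; clearbody D.
rewrite frob_innerNl frob_innerDl frob_innerZl.
rewrite !(frob_innerDr _ (Y - X)) !(frob_innerNr _ D) (frob_innerC G D) => h.
have am2 : frob_inner D V <= e * frob_inner V V + e.
  by rewrite -(ler_pM2l (x := 4 * e)) ?mulr_gt0//; lra.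
(* Expanded, [h] says |D|^2 <= tau <G, Y - X> + <D, V>. *)
by rewrite VE in am2; lra.
Qed.

Lemma entry_continuous_id : entry_continuous (@idfun 'M[R]_(C, N)).
Proof. by move=> i j; exact: coord_continuous. Qed.

Lemma entry_continuous_grad : entry_continuous (@grad_objective R C N S).
Proof.
have idc := entry_continuous_id.
apply: entry_continuousZ; apply: (entry_continuousM idfun) => //.
apply: entry_continuousB; first exact: entry_continuous_cst.
by apply: entry_continuousM => //; exact: entry_continuous_tr.
Qed.

Lemma closed_feasible : closed (@feasible R C N).
Proof.
have -> : @feasible R C N =
    \bigcap_(ki in [set: 'I_C * 'I_N])
      ((fun X : 'M[R]_(C, N) => X ki.1 ki.2) @^-1` [set x | 0 <= x] `&`
       (fun X : 'M[R]_(C, N) => X ki.1 ki.2) @^-1` [set x | x <= 1]) `&`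
    \bigcap_(i in [set: 'I_N])
      ((fun X : 'M[R]_(C, N) => \sum_k X k i) @^-1` [set 1]).
  apply/seteqP; split=> X /=.
    move=> [X01 X1]; split=> [[k i] _|i _] /=; last exact: X1.
    by have /andP[] := X01 k i.
  move=> [X01 X1]; split=> [k i|i]; last exact: X1.
  by have [/= -> ->] := X01 (k, i) I.
apply: closedI; apply: closed_bigI => i _.
  apply: closedI; (apply: closed_comp; [by move=> X _; exact: coord_continuous|]).
    exact: closed_ge.
  exact: closed_le.
apply: closed_comp; last exact: closed_eq.
by move=> X _; apply: continuous_sum => k; exact: coord_continuous.
Qed.

End Descent.

(** * Limits along the sequence of iterates *)

Lemma cluster_closed {T : topologicalType} (u : nat -> T) (A : set T) x :
  closed A -> (\forall n \near \oo, A (u n)) -> cluster (u @ \oo) x -> A x.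
Proof. by move=> Ac uA ux; apply: Ac => B xB; exact: ux. Qed.

(** The sequence converges by monotonicity and its shift has the same limit. Applied to f(X^n), this
    squeezes |X^{n+1} - X^n|^2 to 0. *)
Lemma nonincreasing_diff_cvg0 {R : realType} (u : R^nat) :
  nonincreasing_seq u -> (forall n, 0 <= u n) ->
  (fun n => u n - u n.+1) @ \oo --> (0 : R).
Proof.
move=> ui u0.
have uc : u @ \oo --> lim (u @ \oo).
  apply: nonincreasing_is_cvgn => //.
  by exists 0 => _ [n _ <-].
rewrite -(subrr (lim (u @ \oo))); apply: cvgB => //.
by rewrite cvg_shiftS.
Qed.

Theorem theorem3p1 (R : realType) (N C : nat) (S : 'M[R]_N)
    (hN : (1 <= N)%N) (hC : (1 <= C)%N)
    (hS : forall i j, 0 <= S i j <= 1) (hSsym : S^T = S) :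
  exists taubar : R, 0 < taubar /\
  forall tau : R, 0 < tau < taubar ->
  forall X0 : 'M[R]_(C, N), feasible X0 ->
  let f : 'M[R]_(C, N) -> R := objective S in
  let X : nat -> 'M[R]_(C, N) := pgp S (fun=> tau) X0 in
  (nonincreasing_seq (fun n => f (X n)) /\
   forall n, ~ critical_point feasible f (X n) -> f (X n.+1) < f (X n)) /\
  ((fun n => frob_norm (X n.+1 - X n)) @ \oo --> (0 : R) /\
   forall Xbar : 'M[R]_(C, N),
     cluster (X @ \oo) Xbar -> critical_point feasible f Xbar).
Proof.
have M0 := @remainder_bound_ge0 R C N S; set M := @remainder_bound R C N S in M0.
have M1 : 0 < M + 1 by rewrite ltr_pwDr.
exists (M + 1)^-1; split=> [|tau /andP[t0 tM] X0 X0f]; first by rewrite invr_gt0.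
have tM1 : tau * (M + 1) <= 1.
  by rewrite -ler_pdivlMr// div1r ltW.
move=> f X.
have Xf n : feasible (X n).
  by case: n => [//|n]; exact: (pgp_stepP S tau (X n) hC).1.
have fdec n : f (X n.+1) + frob_inner (X n.+1 - X n) (X n.+1 - X n) <= f (X n).
  exact: pgp_step_descent.
have fni : nonincreasing_seq (fun n => f (X n)).
  apply/nonincreasing_seqP => n; apply: (le_trans _ (fdec n)).
  by rewrite lerDl frob_inner_ge0.
have D0 : (fun n => frob_inner (X n.+1 - X n) (X n.+1 - X n)) @ \oo --> (0 : R).
  apply: (@squeeze_cvgr _ _ _ _ (cst 0) (fun n => f (X n) - f (X n.+1))).
  - apply: nearW => n; rewrite frob_inner_ge0 /= lerBrDl; exact: fdec.
  - exact: cvg_cst.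
  - by apply: nonincreasing_diff_cvg0 fni _ => n; exact: objective_ge0.
split; split=> //.
(* If f(X^{n+1}) = f(X^n), then [fdec] makes the squared step vanish, so X^n is a fixed point and
   hence critical. *)
- move=> n Xncrit; rewrite lt_neqAle fni// andbT; apply/eqP => fE.
  apply: Xncrit; apply: (pgp_step_fixed_critical _ hC hSsym tau) => //.
  apply: subr0_eq; apply: frob_inner_eq0; apply: le_anti.
  by rewrite frob_inner_ge0 andbT; have := fdec n; rewrite fE gerDl.
- rewrite -[X in _ --> X](@sqrtr0 R).
  exact: (cvg_comp _ _ D0 (@sqrt_continuous R 0)).
- move=> Xbar Xcl; split.
    by apply: (cluster_closed X _ _ _ _ Xcl); [exact: closed_feasible|exact: nearW].
  move=> Y Yf; rewrite gradient_objective//.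
  pose G := @grad_objective R C N S.
  (* For fixed e > 0, [phi e] is continuous and eventually nonnegative along the sequence, hence
     nonnegative at the cluster point; only then is e made small. It involves X^n alone and not
     X^{n+1}. *)
  pose phi (e : R) Z := tau * frob_inner (G Z) (Y - Z)
    + e * frob_inner (Y - Z - tau *: G Z) (Y - Z - tau *: G Z) + e.
  have phi0 (e : R) : 0 < e -> 0 <= phi e Xbar.
    move=> e0; apply: (cluster_closed X [set Z | 0 <= phi e Z] _ _ _ Xcl).
      apply: (@closed_comp _ _ (phi e) [set x | 0 <= x]); last exact: closed_ge.
      move=> Z _.
      have Yc : entry_continuous (fun Z : 'M[R]_(C, N) => Y - Z).
        by apply: entry_continuousB;
          [exact: entry_continuous_cst|exact: entry_continuous_id].
      have Gc : entry_continuous G by exact: entry_continuous_grad.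
      have Vc : entry_continuous (fun Z : 'M[R]_(C, N) => Y - Z - tau *: G Z).
        by apply: entry_continuousB => //; apply: entry_continuousZ.
      rewrite (_ : phi e = (cst tau \* (fun Z => frob_inner (G Z) (Y - Z)))
          + (cst e \* (fun Z =>
            frob_inner (Y - Z - tau *: G Z) (Y - Z - tau *: G Z)))
          + cst e) //.
      by apply: continuousD; [|exact: cst_continuous];
        apply: continuousD; apply: continuousM;
        by [exact: cst_continuous|exact: frob_inner_entry_continuous].
    have e2 : 0 < 4 * e ^+ 2 by rewrite mulr_gt0// exprn_gt0.
    have /cvgrPdist_le/(_ _ e2) := D0; apply: filterS => n /= De.
    apply: (pgp_step_variational S hC) => //.
    by move: De; rewrite sub0r normrN ger0_norm// frob_inner_ge0.
  rewrite -(pmulr_rge0 _ t0).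
  set v := frob_inner (Y - Xbar - tau *: G Xbar) (Y - Xbar - tau *: G Xbar).
  have v1 : 0 < v + 1 by rewrite ltr_pwDr// frob_inner_ge0.
  apply/ler_addgt0Pl => e e0.
  (* With parameter d = e / (v + 1) the error d v + d is exactly e. *)
  have := phi0 _ (divr_gt0 e0 v1); rewrite /phi -/v.
  have eE : e / (v + 1) * (v + 1) = e by rewrite divfK// gt_eqF.
  by move: (e / (v + 1)) eE => d eE; rewrite -eE; lra.
Qed.
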